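(* Let $0\le \alpha_1\le\alpha_2\le 0.5$ and $\mathcal I=[\alpha_1,\alpha_2]$. Let $(x_1^*,y_1^* )\in\mathcal X\times\mathcal X$ be an optimal solution of $$\min_{x,y\in\mathcal X}\; g(x,y,\alpha_1)+(\alpha_2-\alpha_1)\,\underline{\partial g}(x,y),$$ and let $(x_2^*,y_2^* )\in\mathcal X\times\mathcal X$ be an optimal solution of $$\min_{x,y\in\mathcal X}\; g(x,y,\alpha_2)+(\alpha_1-\alpha_2)\,\overline{\partial g}(x,y).$$ Assume $\underline{\partial g}(x_1^*,y_1^* )\neq\overline{\partial g}(x_2^*,y_2^* )$. Then the number $$L(\mathcal I)=h(\alpha_1)+\left(\frac{h(\alpha_2)-h(\alpha_1)+\alpha_1\,\underline{\partial g}(x_1^*,y_1^* )-\alpha_2\,\overline{\partial g}(x_2^*,y_2^* )}{\underline{\partial g}(x_1^*,y_1^* )-\overline{\partial g}(x_2^*,y_2^* )}-\alpha_1\right)\underline{\partial g}(x_1^*,y_1^* )$$ is a lower bound for $h$ on $\mathcal I$, i.e. $L(\mathcal I)\le\min_{\alpha\in[\alpha_1,\alpha_2]}h(\alpha)$.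
   Context: Let $n\ge 1$, $[n]=\{1,\dots,n\}$, and let $\mathcal X\subseteq\{0,1\}^n$ be a nonempty set (feasible set of a combinatorial optimization problem). Let $\hat c\in\mathbb R^n$ (nominal costs), $d\in\mathbb R^n_+$ (nonnegative deviations), and let $\Gamma$ be a positive integer (budget of uncertainty). For $v\in\mathbb R^n$ with nonnegative entries, $\|v\|^{(\Gamma)}$ denotes the sum of the $\Gamma$ largest entries of $v$ (the sum of all entries if $\Gamma\ge n$). For $x,y\in\mathcal X$ and $\alpha\in[0,0.5]$ define $$g(x,y,\alpha)=\alpha\sum_{i\in[n]}\hat c_i x_i+(1-\alpha)\sum_{i\in[n]}\hat c_i y_i+\left\|\big(d_i x_i\alpha+d_i y_i(1-\alpha)\big)_{i\in[n]}\right\|^{(\Gamma)},$$ $$h(\alpha)=\min_{x,y\in\mathcal X} g(x,y,\alpha).$$ (Equivalently, $h(\alpha)$ is the optimal value, for fixed $\alpha$, of minimizing $\alpha\sum_i\hat c_i x_i+(1-\alpha)\sum_i\hat c_i y_i+\sum_i\gamma_i+\Gamma\theta$ over $x,y\in\mathcal X$, $\theta\ge 0$, $\gamma\in\mathbb R^n_+$ subject to $d_i x_i\alpha+d_i y_i(1-\alpha)-\theta\le\gamma_i$ for all $i\in[n]$.) Further define, for $x,y\in\mathcal X$, $$\underline{\partial g}(x,y)=\sum_{i\in[n]}\hat c_i x_i-\sum_{i\in[n]}\hat c_i y_i-\left\|(d_i y_i)_{i\in[n]}\right\|^{(\Gamma)},$$ $$\overline{\partial g}(x,y)=\sum_{i\in[n]}\hat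 c_i x_i-\sum_{i\in[n]}\hat c_i y_i+\left\|(d_i x_i)_{i\in[n]}\right\|^{(\Gamma)}.$$ *)

(* Defs.v *)
From HB Require Import structures.
From mathcomp Require Import all_boot all_order all_algebra.
From mathcomp Require Import reals.

Set Implicit Arguments.
Unset Strict Implicit.
Unset Printing Implicit Defensive.

Import Order.TTheory GRing.Theory Num.Theory.
Local Open Scope ring_scope.

Notation binvec n := {ffun 'I_n -> bool}.

Section MinOver.
Context {R : realType} {T : finType}.

(* Seeding the iterated minimum with one of the values makes this the genuine
   minimum whenever A is nonempty (see min_overP); it is 0 if A is empty. *)
Definition min_over (A : {set T}) (f : T -> R) : R :=
  let s := [seq f t | t in A] in \big[Num.min/head 0 s]_(v <- s) v.

Lemma min_overP (A : {set T}) (f : T -> R) : A != set0 ->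
  (exists2 t, t \in A & min_over A f = f t) /\
  (forall t, t \in A -> min_over A f <= f t).
Proof.
move=> /set0Pn[t0 t0A]; rewrite /min_over.
set s := [seq f t | t in A].
have fs t : t \in A -> f t \in s by move=> tA; apply: image_f.
have hs : head 0 s \in s.
  by move: (fs _ t0A); case: (s) => //= v s' _; rewrite mem_head.
split.
- suff /imageP[t tA ->] : \big[Num.min/head 0 s]_(v <- s) v \in s by exists t.
  rewrite big_seq_cond.
  apply: (big_ind (fun v => v \in s)) => // [v w vs ws|v /andP[]//].
  by rewrite /Num.min; case: ifP.
- move=> t /fs; move: (f t) (head 0 s); elim: (s) => // w s' IH v h.
  rewrite inE big_cons ge_min => /predU1P[->|/IH ->]; first by rewrite lexx.
  by rewrite orbT.
Qed.

End MinOver.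

Section Problem.
Context {R : realType} {n : nat}.

(* take returns the whole sequence when Gamma >= n. *)
Definition gamma_norm (Gamma : nat) (v : 'I_n -> R) : R :=
  \sum_(z <- take Gamma (sort >=%R [seq v i | i : 'I_n])) z.

Definition dotb (c : 'I_n -> R) (x : binvec n) : R := \sum_i c i * (x i)%:R.

Variables (c d : 'I_n -> R) (Gamma : nat).
Implicit Types (x y : binvec n) (X : {set binvec n}) (a : R).

Definition g x y a : R :=
  a * dotb c x + (1 - a) * dotb c y
  + gamma_norm Gamma (fun i => d i * (x i)%:R * a + d i * (y i)%:R * (1 - a)).

Definition h X a : R := min_over (setX X X) (fun p => g p.1 p.2 a).

Definition dg_lower x y : R :=
  dotb c x - dotb c y - gamma_norm Gamma (fun i => d i * (y i)%:R).

Definition dg_upper x y : R :=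
  dotb c x - dotb c y + gamma_norm Gamma (fun i => d i * (x i)%:R).

Definition optimal X (F : binvec n -> binvec n -> R) x y : Prop :=
  [/\ x \in X, y \in X &
      forall x' y', x' \in X -> y' \in X -> F x y <= F x' y'].

End Problem.

(* Main.v *)
(* Writing the Gamma-norm as a maximum of sums over index sets of size at most
   Gamma makes it monotone and sublinear on nonnegative vectors, so that on [0, 1]
   every chord of [g x y] has slope between [dg_lower x y] and [dg_upper x y].
   Interpolating the optimality of (x1, y1) between a1 and a2 turns this into the
   lower bound H a1 + (a - a1) l for H a, and symmetrically H a2 + (a - a2) u; L is
   the height at which these two lines cross. That height bounds H from below only
   because l <= 0 <= u, which comes from comparing (x1, y1) with (y1, y1) and
   (x2, y2) with (x2, x2). *)
Require Import Defs.
From HB Require Import structures.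
From mathcomp Require Import all_boot all_order all_algebra.
From mathcomp Require Import reals.
From mathcomp Require Import topology normedtype derive.
From mathcomp Require Import lra.

Set Implicit Arguments.
Unset Strict Implicit.
Unset Printing Implicit Defensive.

Import Order.TTheory GRing.Theory Num.Theory.
Import numFieldNormedType.Exports.
Local Open Scope ring_scope.

(** * Sums of leading entries of a nonincreasing sequence *)

Section SortedSums.
Context {R : realDomainType} {T : eqType}.
Variables (v : T -> R) (v_ge0 : forall i, 0 <= v i).
Implicit Types (s : seq T) (k : nat).

Let geR := relpre v (>=%R : rel R).

(** Each entry of [s] is at most its predecessor in [i :: s], so shifting by one place gives the
    bound; if [s] is too short, the surplus term on the right is nonnegative. *)
Lemma sum_takeS_le i s k : sorted geR (i :: s) ->
  \sum_(j <- take k.+1 s) v j <= v i + \sum_(j <- take k s) v j.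
Proof.
elim: s i k => [|j s IH] i k /=; first by rewrite !big_nil addr0.
move=> /andP[vji pjs]; rewrite big_cons; case: k => [|k].
  by rewrite take0 !big_nil !addr0.
by rewrite /= big_cons; apply: lerD => //; apply: IH.
Qed.

Lemma sum_pred_le_take (S : pred T) s k : sorted geR s -> (count S s <= k)%N ->
  \sum_(i <- s | S i) v i <= \sum_(i <- take k s) v i.
Proof.
elim: s k => [|i s IH] k; first by rewrite !big_nil.
move=> is_sorted; have s_sorted := path_sorted is_sorted.
rewrite big_cons /=; case: (S i) => /= cS.
  case: k cS => // k cS; rewrite big_cons.
  by apply: lerD => //; apply: IH.
case: k cS => [|k] cS; first by rewrite (le_trans (IH 0 _ _)) ?take0.
(* The head is outside [S]: exchanging the last entry taken from the tail for it does not lower the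
   sum. *)
by rewrite big_cons; apply: le_trans (sum_takeS_le k is_sorted); apply: IH.
Qed.

End SortedSums.

(** * The Gamma-norm as a maximum over index sets *)

Section GammaNorm.
Context {R : realType} {n : nat}.
Variable Gamma : nat.
Implicit Types (v w u : 'I_n -> R) (S : {set 'I_n}).
Local Notation N := (gamma_norm Gamma).

Lemma eq_gamma_norm v w : v =1 w -> N v = N w.
Proof. by move=> vw; rewrite /gamma_norm (eq_image (frefl _) vw). Qed.

(** Sorting indices instead of values lets the leading entries be read as an index set, even with
    ties. *)
Lemma gamma_normE v :
  N v = \sum_(i <- take Gamma (sort (relpre v >=%R) (enum 'I_n))) v i.
Proof. by rewrite /gamma_norm sort_map -map_take big_map. Qed.

Lemma sum_le_gamma_norm v S : (forall i, 0 <= v i) -> (#|S| <= Gamma)%N ->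
  \sum_(i in S) v i <= N v.
Proof.
move=> v0 cS; rewrite gamma_normE; set s := sort _ _.
have sE : perm_eq s (enum 'I_n) by rewrite perm_sort.
have -> : \sum_(i in S) v i = \sum_(i <- s | i \in S) v i.
  by rewrite (perm_big _ sE) big_enum_cond.
apply: sum_pred_le_take => //.
  by apply: sort_sorted => i j; apply: ge_total.
by move/permP: sE => ->; rewrite -sum1_count big_enum_cond sum1_card.
Qed.

Lemma gamma_norm_attained v :
  exists2 S : {set 'I_n}, (#|S| <= Gamma)%N & N v = \sum_(i in S) v i.
Proof.
rewrite gamma_normE; set s := take _ _.
have us : uniq s by rewrite take_uniq // sort_uniq enum_uniq.
exists [set i in s]; first by rewrite cardsE (card_uniqP us) size_take_min geq_minl.
by rewrite big_uniq //=; apply: eq_bigl => i; rewrite inE.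
Qed.

Lemma gamma_norm_ge0 v : (forall i, 0 <= v i) -> 0 <= N v.
Proof.
by move=> v0; have := @sum_le_gamma_norm v set0 v0; rewrite big_set0 cards0; apply.
Qed.

(** A set attaining [N v] also competes in [N w] and [N u], so the entrywise inequality is summed
    over it. This is the form the chord estimates use. *)
Lemma gamma_norm_leD v w u t : (forall i, 0 <= w i) -> (forall i, 0 <= u i) ->
  0 <= t -> (forall i, v i <= w i + t * u i) -> N v <= N w + t * N u.
Proof.
move=> w0 u0 t0 vwu; have [S cS ->] := gamma_norm_attained v.
apply: le_trans (ler_sum _ (fun i _ => vwu i)) _.
rewrite big_split -mulr_sumr; apply: lerD; first exact: sum_le_gamma_norm.
by apply: ler_wpM2l => //; apply: sum_le_gamma_norm.
Qed.

(** Used with [t] the weight of one solution in a mixture [w], to discard the other solution. *)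
Lemma gamma_norm_geZ v w t : (forall i, 0 <= w i) ->
  (forall i, t * v i <= w i) -> t * N v <= N w.
Proof.
move=> w0 vw; have [S cS ->] := gamma_norm_attained v.
rewrite mulr_sumr; apply: le_trans (ler_sum _ (fun i _ => vw i)) _.
exact: sum_le_gamma_norm.
Qed.

End GammaNorm.

(** * Minima over finite sets and over segments *)

Lemma min_over_geP (R : realType) (T : finType) (A : {set T}) (f : T -> R) m :
  A != set0 -> (forall t, t \in A -> m <= f t) -> m <= min_over A f.
Proof. by move=> /(min_overP f)[[t tA ->] _] /(_ t tA). Qed.

Lemma segment_slopes_attains_min (R : realType) (f : R -> R) (a b k K : R) :
  a <= b ->
  (forall s t, a <= s -> s <= t -> t <= b ->
     k * (t - s) <= f t - f s <= K * (t - s)) ->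
  exists2 m, a <= m <= b & forall t, a <= t <= b -> f m <= f t.
Proof.
(* [M] is a Lipschitz constant, which yields continuity on the segment; the summand 1 keeps it
   positive so that [e / M] makes sense. *)
move=> ab slope; pose M := `|k| + `|K| + 1.
have M0 : 0 < M by rewrite /M ltr_wpDl // addr_ge0.
have lip s t : a <= s <= b -> a <= t <= b -> `|f s - f t| <= M * `|s - t|.
  wlog st : s t / s <= t => [wl|] sI tI.
    have [/wl|/ltW ts] := leP s t; first exact.
    by rewrite distrC (distrC s); apply: wl.
  move: sI tI => /andP[a_s _] /andP[_ tb].
  have /andP[lo hi] := slope s t a_s st tb.
  rewrite distrC (distrC s) (ger0_norm (_ : 0 <= t - s)) ?subr_ge0 //.
  have := ler_norm K; have := ler_norm (- k); rewrite normrN => hk hK.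
  have := normr_ge0 K; have := normr_ge0 k => k0 K0.
  by rewrite ler_norml /M; apply/andP; split; nra.
have [|m] := @EVT_min R f a b ab.
  apply/subspace_continuousP => s /=; rewrite in_itv /= => sI.
  apply/cvgrPdist_le => e e0; rewrite near_withinE.
  have: \forall t \near s, `|s - t| <= e / M.
    exact: (cvgr_dist_le id s cvg_id (e / M) (divr_gt0 e0 M0)).
  apply: filterS => t st /=; rewrite in_itv /= => tI.
  by apply: le_trans (lip s t sI tI) _; rewrite mulrC -ler_pdivlMr.
by rewrite in_itv /= => mI min_m; exists m.
Qed.

(** * Chord slopes of [g] in the mixing weight *)

Section Slopes.
Context {R : realType} {n : nat}.
Variables (c d : 'I_n -> R) (d_ge0 : forall i, 0 <= d i) (Gamma : nat).
Implicit Types (x y : binvec n) (a b : R).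
Local Notation N := (gamma_norm Gamma).
Local Notation g := (g c d Gamma).
Local Notation dg_lower := (dg_lower c d Gamma).
Local Notation dg_upper := (dg_upper c d Gamma).

Let dx_ge0 x i : 0 <= d i * (x i)%:R.
Proof. by rewrite mulr_ge0. Qed.

Let mix_ge0 x y a i : 0 <= a -> a <= 1 ->
  0 <= d i * (x i)%:R * a + d i * (y i)%:R * (1 - a).
Proof. by move=> a0 a1; rewrite addr_ge0 // mulr_ge0 // subr_ge0. Qed.

Lemma g_diag x a : g x x a = dotb c x + N (fun i => d i * (x i)%:R).
Proof.
rewrite /Defs.g -mulrDl subrKC mul1r; congr (_ + _).
by apply: eq_gamma_norm => i; rewrite -mulrDr subrKC mulr1.
Qed.

(** From [a] to [b] the weight of [x] grows and that of [y] drops by [b - a], so the mixed vector at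
    [a] exceeds the one at [b] by at most [(b - a) * d i * y i] in each entry. *)
Lemma g_chord_ge x y a b : 0 <= a -> a <= b -> b <= 1 ->
  g x y a + (b - a) * dg_lower x y <= g x y b.
Proof.
move=> a0 ab b1; rewrite /Defs.g /Defs.dg_lower.
have := @gamma_norm_leD R n Gamma
  (fun i => d i * (x i)%:R * a + d i * (y i)%:R * (1 - a))
  (fun i => d i * (x i)%:R * b + d i * (y i)%:R * (1 - b))
  (fun i => d i * (y i)%:R) (b - a).
set Na := N _; set Nb := N _; set Ny := N _ => H.
have {H} : Na <= Nb + (b - a) * Ny.
  apply: H => [i|//||i]; first by apply: mix_ge0; lra.
    by rewrite subr_ge0.
  by have := dx_ge0 x i; have := dx_ge0 y i; nra.
by lra.
Qed.

Lemma g_chord_le x y a b : 0 <= a -> a <= b -> b <= 1 ->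
  g x y b <= g x y a + (b - a) * dg_upper x y.
Proof.
move=> a0 ab b1; rewrite /Defs.g /Defs.dg_upper.
have := @gamma_norm_leD R n Gamma
  (fun i => d i * (x i)%:R * b + d i * (y i)%:R * (1 - b))
  (fun i => d i * (x i)%:R * a + d i * (y i)%:R * (1 - a))
  (fun i => d i * (x i)%:R) (b - a).
set Nb := N _; set Na := N _; set Nx := N _ => H.
have {H} : Nb <= Na + (b - a) * Nx.
  apply: H => [i|//||i]; first by apply: mix_ge0; lra.
    by rewrite subr_ge0.
  by have := dx_ge0 x i; have := dx_ge0 y i; nra.
by lra.
Qed.

(** * Signs of the slopes at the optimal pairs *)

Variable X : {set binvec n}.
Lemma dg_lower_opt_le0 a1 a2 x y :
  0 <= a1 -> a1 < a2 -> a2 <= 1 ->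
  optimal X (fun x y => g x y a1 + (a2 - a1) * dg_lower x y) x y ->
  dg_lower x y <= 0.
Proof.
move=> a1_ge0 a12 a2_le1 [xX yX /(_ y y yX yX)]; rewrite g_diag /Defs.g /Defs.dg_lower.
have := @gamma_norm_geZ R n Gamma (fun i => d i * (y i)%:R)
  (fun i => d i * (x i)%:R * a1 + d i * (y i)%:R * (1 - a1)) (1 - a1).
set Nxy := N (fun i => _ + _); set Ny := N _ => H.
have {H} : (1 - a1) * Ny <= Nxy.
  apply: H => i; first by apply: mix_ge0; lra.
  by have := mulr_ge0 (dx_ge0 x i) a1_ge0; lra.
have : 0 <= Ny by apply: gamma_norm_ge0.
(* With [Nxy] bounded below, [opt] gives [a2 * dg_lower x y <= - (a2 - a1) * Ny], and [a2 > 0]. *)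
move=> Ny0 Nxy_ge opt; rewrite leNgt; apply/negP => l_gt0.
have : 0 < a2 * (dotb c x - dotb c y - Ny) by apply: mulr_gt0; lra.
have : 0 <= (a2 - a1) * Ny by apply: mulr_ge0; lra.
by lra.
Qed.

Lemma dg_upper_opt_ge0 a1 a2 x y :
  0 <= a1 -> a1 < a2 -> a2 <= 1 ->
  optimal X (fun x y => g x y a2 + (a1 - a2) * dg_upper x y) x y ->
  0 <= dg_upper x y.
Proof.
move=> a1_ge0 a12 a2_le1 [xX yX /(_ x x xX xX)]; rewrite g_diag /Defs.g /Defs.dg_upper.
have := @gamma_norm_geZ R n Gamma (fun i => d i * (x i)%:R)
  (fun i => d i * (x i)%:R * a2 + d i * (y i)%:R * (1 - a2)) a2.
set Nxy := N (fun i => _ + _); set Nx := N _ => H.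
have {H} : a2 * Nx <= Nxy.
  apply: H => i; first by apply: mix_ge0; lra.
  by have := mulr_ge0 (dx_ge0 y i) (_ : 0 <= 1 - a2); lra.
have : 0 <= Nx by apply: gamma_norm_ge0.
(* Here [opt] gives [(a2 - a1) * Nx <= (1 - a1) * dg_upper x y], and [1 - a1 > 0]. *)
move=> Nx0 Nxy_ge opt; rewrite leNgt; apply/negP => u_lt0.
have : 0 < (1 - a1) * (dotb c y - dotb c x - Nx) by apply: mulr_gt0; lra.
have : 0 <= (a2 - a1) * Nx by apply: mulr_ge0; lra.
by lra.
Qed.

(** * Lines below [h] *)

Local Notation H := (h c d Gamma X).

Lemma h_le x y a : x \in X -> y \in X -> H a <= g x y a.
Proof.
move=> xX yX; have xyX : (x, y) \in setX X X by rewrite inE xX.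
have XX0 : setX X X != set0 by apply/set0Pn; exists (x, y).
by have [_ /(_ _ xyX)] := min_overP (fun p => g p.1 p.2 a) XX0.
Qed.

Lemma h_ge m a : X != set0 -> (forall x y, x \in X -> y \in X -> m <= g x y a) ->
  m <= H a.
Proof.
move=> /set0Pn[x0 x0X] mg; apply: min_over_geP => [|[x y]].
  by apply/set0Pn; exists (x0, x0); rewrite inE x0X.
by rewrite inE => /andP[/= xX yX]; apply: mg.
Qed.

Lemma h_ge_left_line a1 a2 x1 y1 a :
  0 <= a1 -> a1 < a2 -> a2 <= 1 ->
  optimal X (fun x y => g x y a1 + (a2 - a1) * dg_lower x y) x1 y1 ->
  a1 <= a <= a2 -> H a1 + (a - a1) * dg_lower x1 y1 <= H a.
Proof.
move=> a1_ge0 a12 a2_le1 [x1X y1X opt] /andP[a1a aa2].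
apply: h_ge => [|x y xX yX]; first by apply/set0Pn; exists x1.
have := opt _ _ xX yX; have := h_le a1 xX yX; have := h_le a1 x1X y1X.
have := @g_chord_ge x y _ _ a1_ge0 a1a ltac:(lra).
move: (g x y a1) (g x1 y1 a1) (g x y a) (H a1) => G G1 Ga h1.
move: (dg_lower x1 y1) (dg_lower x y) => l s chord hG1 hG opt'.
rewrite -(ler_pM2l (_ : 0 < a2 - a1)) ?subr_gt0 //.
(* Up to the factor [a2 - a1], [G + (a - a1) * s] is the mean of [G] and [G + (a2 - a1) * s] with
   weights [a2 - a] and [a - a1]; these are at least [h1] and, by optimality,
   [h1 + (a2 - a1) * l]. *)
have : 0 <= (a2 - a) * (G - h1) by apply: mulr_ge0; lra.
have : 0 <= (a - a1) * (G + (a2 - a1) * s - h1 - (a2 - a1) * l)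
  by apply: mulr_ge0; lra.
have : 0 <= (a2 - a1) * (Ga - G - (a - a1) * s) by apply: mulr_ge0; lra.
by lra.
Qed.

Lemma h_ge_right_line a1 a2 x2 y2 a :
  0 <= a1 -> a1 < a2 -> a2 <= 1 ->
  optimal X (fun x y => g x y a2 + (a1 - a2) * dg_upper x y) x2 y2 ->
  a1 <= a <= a2 -> H a2 + (a - a2) * dg_upper x2 y2 <= H a.
Proof.
move=> a1_ge0 a12 a2_le1 [x2X y2X opt] /andP[a1a aa2].
apply: h_ge => [|x y xX yX]; first by apply/set0Pn; exists x2.
have := opt _ _ xX yX; have := h_le a2 xX yX; have := h_le a2 x2X y2X.
have := @g_chord_le x y a a2 ltac:(lra) aa2 ltac:(lra).
move: (g x y a2) (g x2 y2 a2) (g x y a) (H a2) => G G2 Ga h2.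
move: (dg_upper x2 y2) (dg_upper x y) => u s chord hG2 hG opt'.
rewrite -(ler_pM2l (_ : 0 < a2 - a1)) ?subr_gt0 //.
have : 0 <= (a - a1) * (G - h2) by apply: mulr_ge0; lra.
have : 0 <= (a2 - a) * (G + (a1 - a2) * s - h2 - (a1 - a2) * u)
  by apply: mulr_ge0; lra.
have : 0 <= (a2 - a1) * (Ga + (a2 - a) * s - G) by apply: mulr_ge0; lra.
by lra.
Qed.

End Slopes.

(** * Attainment of the minimum of [h], and its lower bound *)

Lemma h_attains_min (R : realType) (n : nat) (X : {set binvec n})
    (c d : 'I_n -> R) (Gamma : nat) (a1 a2 : R) :
  X != set0 -> (forall i, 0 <= d i) -> 0 <= a1 -> a1 <= a2 -> a2 <= 1 ->
  exists2 a0, a1 <= a0 <= a2 &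
    forall a, a1 <= a <= a2 -> h c d Gamma X a0 <= h c d Gamma X a.
Proof.
move=> X0 d_ge0 a1_ge0 a12 a2_le1; have /set0Pn[x0 x0X] := X0.
have gmin (p : binvec n * binvec n) : exists m, a1 <= m <= a2 /\
    forall a, a1 <= a <= a2 -> g c d Gamma p.1 p.2 m <= g c d Gamma p.1 p.2 a.
  have [|m] := @segment_slopes_attains_min R (g c d Gamma p.1 p.2) a1 a2
    (dg_lower c d Gamma p.1 p.2) (dg_upper c d Gamma p.1 p.2) a12.
    move=> s t a1s st ta2.
    have s0 := le_trans a1_ge0 a1s; have t1 := le_trans ta2 a2_le1.
    have := g_chord_ge c d_ge0 Gamma p.1 p.2 s0 st t1.
    have := g_chord_le c d_ge0 Gamma p.1 p.2 s0 st t1.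
    by move=> hi lo; apply/andP; split; lra.
  by move=> mI min_m; exists m.
have [m m_min] := boolp.choice gmin.
(* The two minimizations are exchanged: first over the segment for each pair, then over the finitely
   many pairs in [X]. *)
pose F p := g c d Gamma p.1 p.2 (m p).
have x0X2 : (x0, x0) \in setX X X by rewrite inE x0X.
have [[x y] /setXP[xX yX] F_min] := arg_minP F x0X2.
exists (m (x, y)); first by have [] := m_min (x, y).
move=> a aI; apply: h_ge => // x' y' x'X y'X.
have [_ /(_ _ aI)] := m_min (x', y'); apply: le_trans.
apply: le_trans (F_min (x', y') _); last exact/setXP.
exact: h_le.
Qed.

Theorem theorem3 (R : realType) (n : nat) (n_gt0 : (0 < n)%N)
  (X : {set binvec n}) (X_neq0 : X != set0)
  (c d : 'I_n -> R) (d_ge0 : forall i, 0 <= d i)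
  (Gamma : nat) (Gamma_gt0 : (0 < Gamma)%N)
  (a1 a2 : R) (a1_ge0 : 0 <= a1) (a1_le_a2 : a1 <= a2) (a2_le : a2 <= 1 / 2)
  (x1 y1 x2 y2 : binvec n)
  (opt1 : optimal X (fun x y =>
     g c d Gamma x y a1 + (a2 - a1) * dg_lower c d Gamma x y) x1 y1)
  (opt2 : optimal X (fun x y =>
     g c d Gamma x y a2 + (a1 - a2) * dg_upper c d Gamma x y) x2 y2)
  (neq : dg_lower c d Gamma x1 y1 <> dg_upper c d Gamma x2 y2) :
  let H := h c d Gamma X in
  let l := dg_lower c d Gamma x1 y1 in
  let u := dg_upper c d Gamma x2 y2 in
  let L := H a1 + ((H a2 - H a1 + a1 * l - a2 * u) / (l - u) - a1) * l in
  (forall a, a1 <= a <= a2 -> L <= H a) /\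
  (exists a0, [/\ a1 <= a0 <= a2,
                  forall a, a1 <= a <= a2 -> H a0 <= H a
                & L <= H a0]).
Proof.
move=> H l u L.
have a2_le1 : a2 <= 1.
  by apply: le_trans a2_le _; rewrite mul1r invf_le1 // ler1n.
have lower a : a1 <= a <= a2 -> L <= H a.
  move=> aI; have lu0 : l - u != 0 by rewrite subr_eq0; apply/eqP.
  (* If [a1 = a2], the quotient collapses to [a1] and [L] is [H a1]; the two lines are built only
     for [a1 < a2]. *)
  move: a1_le_a2; rewrite le_eqVlt => /predU1P[a12|a12].
    have -> : a = a1 by apply/le_anti; rewrite {1}a12 andbC.
    rewrite /L -a12 subrr add0r -mulrBr mulfK // subrr mul0r addr0.
    exact: lexx.
  have left := h_ge_left_line d_ge0 a1_ge0 a12 a2_le1 opt1 aI.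
  have right := h_ge_right_line d_ge0 a1_ge0 a12 a2_le1 opt2 aI.
  have l0 : l <= 0 := dg_lower_opt_le0 d_ge0 a1_ge0 a12 a2_le1 opt1.
  have u0 : 0 <= u := dg_upper_opt_ge0 d_ge0 a1_ge0 a12 a2_le1 opt2.
  rewrite -/H -/l -/u in left right; rewrite /L.
  (* [q] is the abscissa at which the two lines cross. *)
  set q := _ / _.
  have qE : H a1 + (q - a1) * l = H a2 + (q - a2) * u.
    have : q * (l - u) = H a2 - H a1 + a1 * l - a2 * u by rewrite divfK.
    by lra.
  (* Before [q] the nonincreasing left line is at least [L]; from [q] on, the nondecreasing right
     line is. *)
  have [aq|/ltW qa] := leP a q; first by apply: le_trans left; nra.
  by rewrite qE; apply: le_trans right; nra.
split=> //; have [a0 a0I a0_min] :=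
  h_attains_min c Gamma X_neq0 d_ge0 a1_ge0 a1_le_a2 a2_le1.
by exists a0; split=> //; apply: lower.
Qed.
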